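(* Let $\mathcal{V}$ be any deterministic, sound, tractable verifier issuing at most $n$ queries. Over the threshold model class $\mathcal{F}_\tau=\{f_\theta:\theta\in[0,1]\}$, $f_\theta(x)=\mathbf{1}[x>\theta]$ on $[0,1]$, there exists a placement of the alignment boundary $\tau$ (where $f_\theta$ is aligned if and only if $\theta\le\tau$) such that $\mathcal{V}$ fails Completeness: all aligned systems $f_{\theta'}$ with $\theta'$ in some interval of measure at least $\frac{1}{2(n+1)}$ are incorrectly rejected by $\mathcal{V}$.
   Context: The threshold model class: $\mathcal{X}=[0,1]$, $\mathcal{Y}=\{0,1\}$, and $f_\theta(x)=\mathbf{1}[x>\theta]$ for $\theta\in[0,1]$. The alignment objective is $A^*(\theta)=1-\theta$ (the Lebesgue measure of inputs on which $f_\theta$ outputs $1$); for an alignment boundary $\tau\in[0,1]$, $f_\theta$ is aligned iff $A^*(\theta)\ge 1-\tau$, i.e. iff $\theta\le\tau$, and misaligned otherwise. A verifier (verification procedure) $\mathcal{V}$ learns about $f_\theta$ by querying its values at points $x_1<\dots<x_n$ of $[0,1]$ and outputs a verdict, ''aligned'' or ''unaligned'' (the latter being a rejection), determined by the answers. Soundness (with respect to the boundary $\tau$): $\mathcal{V}(\theta)=\text{aligned}$ implies $\theta\le\tau$. Completeness: $\theta\le\tau$ implies $\mathcal{V}(\theta)=\text{aligned}$. Tractability: $\mathcal{V}$ terminates in time polynomial in $|\theta|$ (the size of the parameter description). *)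

(* Defs.v *)
From HB Require Import structures.
From mathcomp Require Import all_boot all_order all_algebra.
From mathcomp Require Import all_classical all_reals all_analysis.
Set Implicit Arguments.
Unset Strict Implicit.
Unset Printing Implicit Defensive.
Import Order.TTheory GRing.Theory Num.Theory.
Local Open Scope classical_set_scope.
Local Open Scope ring_scope.

Section ThresholdModels.
Variable R : realType.
Implicit Types theta tau x : R.

Definition threshold theta x : bool := theta < x.

Definition alignment_objective theta : R := 1 - theta.

Definition aligned tau theta : bool := 1 - tau <= alignment_objective theta.

Lemma alignedE tau theta : aligned tau theta = (theta <= tau).
Proof. by rewrite /aligned /alignment_objective lerD2l lerN2. Qed.

Lemma alignment_objectiveE theta : theta \in `[0, 1] ->
  lebesgue_measure [set x | x \in `[0, 1] /\ threshold theta x]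
  = (alignment_objective theta)%:E.
Proof.
rewrite in_itv /= => /andP[t0 t1].
have -> : [set x | x \in `[0, 1] /\ threshold theta x] = [set` `]theta, 1]].
  apply/seteqP; split => x /=; rewrite !in_itv /= /threshold.
    by move=> [/andP[_ ->] ->].
  by move=> /andP[tx x1]; rewrite x1 tx (le_trans t0 (ltW tx)).
rewrite lebesgue_measure_itv /= lte_fin.
case: ltP => [_|t1']; first by rewrite -EFinB.
by rewrite /alignment_objective (@le_anti _ _ theta 1) ?subrr // t1.
Qed.

End ThresholdModels.

Inductive verdict := Aligned | Unaligned.

(* Deterministic one-tape Turing machines whose input is a word of bits and
   whose output is a verdict. A tape symbol is [None] (blank), [Some (inl b)]
   (an input bit) or [Some (inr s)] (an auxiliary symbol). A transition either
   halts with a verdict or gives the next control state, the symbol to write,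
   and the direction of the move ([true] for right). *)
Record machine := Machine {
  control : finType;
  auxiliary : finType;
  start : control;
  transition : control -> option (bool + auxiliary) ->
    verdict + (control * option (bool + auxiliary) * bool) }.

Section Runs.
Variable M : machine.
Local Notation symbol := (option (bool + auxiliary M)).

(* [(q, l, r)]: control state [q]; [l] is the tape to the left of the head,
   nearest cell first; [r] is the rest, starting with the scanned cell. Cells
   beyond the ends of [l] and [r] are blank. *)
Definition config := (control M * seq symbol * seq symbol)%type.

Definition initial (w : seq bool) : config :=
  (start M, [::], [seq Some (inl b) | b <- w]).

Definition step (c : config) : verdict + config :=
  let: (q, l, r) := c in
  match transition q (head None r) with
  | inl v => inl v
  | inr (q', s, true) => inr (q', s :: l, behead r)
  | inr (q', s, false) => inr (q', behead l, head None l :: s :: behead r)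
  end.

(* [Some v] when [M] halts with verdict [v] within [t] transitions. *)
Fixpoint run (t : nat) (c : config) : option verdict :=
  if t is t'.+1 then
    match step c with
    | inl v => Some v
    | inr c' => run t' c'
    end
  else None.

End Runs.

(* The query points are fixed before the boundary is placed; the program that
   turns the answers into a verdict may depend on the boundary [tau]. (Queries
   placed after [tau] could include [tau] itself, which separates
   [theta < tau] from [theta >= tau].) *)
Record verifier (R : realType) := Verifier {
  queries : seq R;
  program : R -> machine;
  queries_sorted : sorted <%R queries;
  queries_unit : {in queries, forall x, x \in `[0, 1]} }.

Section Verifiers.
Variables (R : realType) (V : verifier R).
Implicit Types theta tau : R.

Definition answers theta : seq bool := map (threshold theta) (queries V).

Definition outputs_in tau theta (t : nat) (v : verdict) : Prop :=
  run t (initial (program V tau) (answers theta)) = Some v.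

Definition outputs tau theta (v : verdict) : Prop :=
  exists t, outputs_in tau theta t v.

Definition sound tau : Prop :=
  forall theta, theta \in `[0, 1] ->
    outputs tau theta Aligned -> aligned tau theta.

Definition complete tau : Prop :=
  forall theta, theta \in `[0, 1] ->
    aligned tau theta -> outputs tau theta Aligned.

(* [dsize theta] is the size of the description of the parameter [theta].
   Each query costs one unit of time. *)
Definition tractable (dsize : R -> nat) tau : Prop :=
  exists p : {poly nat}, forall theta, theta \in `[0, 1] ->
    exists t v, outputs_in tau theta t v /\
      (size (queries V) + t <= p.[dsize theta])%N.

End Verifiers.

(* Main.v *)
(* The at most n queries cut [0, 1] into at most n + 1 gaps, one of which, [a, b[,
   has length at least 1 / (n + 1); all thresholds in it give the same answers.
   Place tau at its midpoint. A threshold of ]tau, b[ is misaligned, so soundness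
   forbids the verdict "aligned" on these common answers; hence every threshold
   of [a, tau] is rejected. *)
Require Import Defs.
From HB Require Import structures.
From mathcomp Require Import all_boot all_order all_algebra.
From mathcomp Require Import all_classical all_reals all_analysis.
From mathcomp Require Import lra.
Set Implicit Arguments.
Unset Strict Implicit.
Unset Printing Implicit Defensive.
Import Order.TTheory GRing.Theory Num.Theory.
Local Open Scope classical_set_scope.
Local Open Scope ring_scope.

(** Pigeonhole by induction on [s], with the left end [c] moving to the head of the list.
    Multiplying by the number of gaps avoids division. *)
Lemma exists_large_gap (R : realDomainType) (c d : R) (s : seq R) :
  path <=%R c s -> all (<= d) s ->
  exists a b, [/\ c <= a, b <= d, d - c <= (size s).+1%:R * (b - a) &
    {in s, forall x, x <= a \/ b <= x}].
Proof.
elim: s c => [|x s IHs] c /=; first by exists c, d; rewrite mul1r.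
move=> /andP[cx xs] /andP[xd sd].
have [a [b [xa bd dx gap]]] := IHs _ xs sd.
(* The longer of the first gap, from [c] to [x], and the gap found in the tail is kept: the other
   one adds at most its length to the bound. *)
have [le_ba|/ltW le_cx] := leP (x - c) (b - a).
  exists a, b; split => //; first exact: le_trans xa.
    by rewrite -natr1 mulrDl mul1r; lra.
  by move=> y; rewrite inE => /predU1P[->|/gap//]; left.
exists c, x; split => //.
  have : (size s).+1%:R * (b - a) <= (size s).+1%:R * (x - c).
    by rewrite ler_wpM2l.
  by rewrite -[(size s).+2%:R]natr1 mulrDl mul1r; lra.
move=> y; rewrite inE => /predU1P[->|ys]; right => //.
by move: xs; rewrite (path_sortedE le_trans) => /andP[/allP/(_ _ ys)].
Qed.

(** As [threshold] is strict, a query at [a] is already negative for the threshold [a], while a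
    query at [b] turns negative only at [b]; hence the half-open gap. *)
Lemma answers_constant_on_gap (R : realType) (V : verifier R) (a b u v : R) :
  {in queries V, forall x, x <= a \/ b <= x} ->
  a <= u < b -> a <= v < b -> answers V u = answers V v.
Proof.
move=> gap /andP[au ub] /andP[av vb]; apply/eq_in_map => x /gap.
rewrite /threshold => -[xa|bx].
  by rewrite !ltNge (le_trans xa au) (le_trans xa av).
by rewrite (lt_le_trans ub bx) (lt_le_trans vb bx).
Qed.

Theorem proposition2 (R : realType) (n : nat) (dsize : R -> nat)
    (V : verifier R)
    (V_queries : (size (queries V) <= n)%N)
    (V_sound : forall tau : R, tau \in `[0, 1] -> sound V tau)
    (V_tractable : forall tau : R, tau \in `[0, 1] -> tractable V dsize tau) :
  exists tau : R, [/\ tau \in `[0, 1],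
    ~ complete V tau &
    exists I : interval R,
      [/\ [set` I] `<=` [set` `[0, 1]],
          (((2 * n.+1%:R)^-1)%:E <= lebesgue_measure [set` I])%E &
          forall theta : R, theta \in I ->
            aligned tau theta /\ outputs V tau theta Unaligned]].
Proof.
have q01 x : x \in queries V -> 0 <= x <= 1.
  by move=> /(@queries_unit _ V); rewrite in_itv.
have q_path : path <=%R 0 (queries V).
  rewrite (path_sortedE le_trans) (sub_sorted _ (queries_sorted V)) ?andbT.
    by apply/allP => x /q01 /andP[].
  by move=> x y /ltW.
have q_le1 : all (<= 1) (queries V) by apply/allP => x /q01 /andP[].
have [a [b [a0 b1 long gap]]] := exists_large_gap q_path q_le1.
have ab : a < b.
  rewrite ltNge; apply/negP => ba.
  have : (size (queries V)).+1%:R * (b - a) <= 0 by rewrite mulr_ge0_le0 ?subr_le0.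
  lra.
have len : (n.+1%:R)^-1 <= b - a.
  rewrite -[leLHS]mulr1 ler_pdivrMl ?ltr0Sn//.
  have : (size (queries V)).+1%:R * (b - a) <= n.+1%:R * (b - a).
    by rewrite ler_wpM2r ?subr_ge0 ?(ltW ab) ?ler_nat.
  lra.
(* [theta'] is the misaligned witness: beyond [tau], yet still in the gap. *)
pose tau := (a + b) / 2; pose theta' := (tau + b) / 2.
have tau01 : tau \in `[0, 1] by rewrite in_itv /= /tau; lra.
have theta'01 : theta' \in `[0, 1] by rewrite in_itv /= /theta' /tau; lra.
have theta'_gap : a <= theta' < b by rewrite /theta' /tau; lra.
have not_aligned theta : a <= theta <= tau -> ~ outputs V tau theta Aligned.
  move=> theta_tau; have theta_gap : a <= theta < b by move: theta_tau; rewrite /tau; lra.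
  rewrite /outputs /outputs_in (answers_constant_on_gap gap theta_gap theta'_gap).
  by move=> /(V_sound _ tau01 _ theta'01); rewrite alignedE /theta' /tau; lra.
have a_tau : a <= tau by rewrite /tau; lra.
exists tau; split => //.
  (* The boundary threshold [tau] is itself aligned but not accepted. *)
  move=> /(_ tau tau01); rewrite alignedE lexx => /(_ isT).
  by apply: not_aligned; rewrite a_tau lexx.
exists `[a, tau]; split.
- by move=> x /=; rewrite !in_itv /= /tau; lra.
- have a_lt_tau : a < tau by rewrite /tau; lra.
  rewrite lebesgue_measure_itv /= lte_fin a_lt_tau -EFinB lee_fin invfM.
  by move: len; rewrite /tau; set inv_n := _^-1; lra.
- move=> theta; rewrite in_itv /= => theta_tau.
  have theta01 : theta \in `[0, 1].
    by move: theta_tau; rewrite in_itv /= /tau; lra.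
  split; first by rewrite alignedE; case/andP: theta_tau.
  (* Tractability provides a verdict, so that not accepting means rejecting. *)
  have [p /(_ theta theta01) [t [v [out _]]]] := V_tractable _ tau01.
  case: v out => out; last by exists t.
  by case: (not_aligned _ theta_tau); exists t.
Qed.
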